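(* Assume $\mathrm{cov}(\mathcal{M})=\mathfrak{c}$. Then there exists a Mazurkiewicz set $M\subseteq\mathbb{R}^2$ such that for every rotation $\rho$ of $\mathbb{R}^2$ about the origin, $\rho[M]$ is a Sierpiński-Zygmund set.
   Context: $\mathfrak{c}$ denotes the cardinality of $\mathbb{R}$. $\mathrm{cov}(\mathcal{M})=\mathfrak{c}$ means that $\mathbb{R}$ cannot be covered by fewer than $\mathfrak{c}$ meager subsets of $\mathbb{R}$ (a meager set being a countable union of nowhere dense sets). Partial functions from $\mathbb{R}$ into $\mathbb{R}$ are identified with their graphs. A Mazurkiewicz set is a set $M\subseteq\mathbb{R}^2$ that intersects every straight line of $\mathbb{R}^2$ in exactly two points (every rotation of a Mazurkiewicz set about the origin is again a Mazurkiewicz set). A set $X\subseteq\mathbb{R}^2$ is a Sierpiński-Zygmund set if $|X\cap f|<\mathfrak{c}$ for every continuous partial function $f$ from $\mathbb{R}$ into $\mathbb{R}$ (continuous function defined on some subset of $\mathbb{R}$). *)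

(* Defs.v *)
From mathcomp Require Import all_boot all_order all_algebra.
From mathcomp Require Import all_classical all_reals all_analysis.
Import Order.TTheory GRing.Theory Num.Theory.
Import numFieldNormedType.Exports.

Set Implicit Arguments.
Unset Strict Implicit.
Unset Printing Implicit Defensive.

Local Open Scope classical_set_scope.
Local Open Scope card_scope.
Local Open Scope ring_scope.

Definition card_lt (T U : Type) (A : set T) (B : set U) : Prop :=
  A #<= B /\ ~ (B #<= A).

Definition nowhere_dense (T : topologicalType) (A : set T) : Prop :=
  interior (closure A) = set0.

Definition meager (T : topologicalType) (A : set T) : Prop :=
  exists F : nat -> set T,
    (forall n, nowhere_dense (F n)) /\ A = \bigcup_n F n.

Definition cov_meager_eq_continuum (R : realType) : Prop :=
  forall F : set (set R),
    card_lt F [set: R] -> (forall A, F A -> meager A) ->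
    \bigcup_(A in F) A <> [set: R].

Definition is_line (R : realType) (L : set (R * R)) : Prop :=
  exists a b c : R,
    (a, b) <> (0, 0) /\ L = [set p | a * p.1 + b * p.2 = c].

Definition mazurkiewicz (R : realType) (M : set (R * R)) : Prop :=
  forall L, is_line L -> exists p q, p <> q /\ M `&` L = [set p; q].

Definition graph_on (R : realType) (D : set R) (f : R -> R) : set (R * R) :=
  [set p | D p.1 /\ p.2 = f p.1].

(* The partial function with domain D is represented by a total f; only the
   values of f on D matter, both in graph_on and in {within D, continuous f}. *)
Definition sierpinski_zygmund (R : realType) (X : set (R * R)) : Prop :=
  forall (D : set R) (f : R -> R), {within D, continuous f} ->
    card_lt (X `&` graph_on D f) [set: R].

Definition rotation (R : realType) (t : R) (p : R * R) : R * R :=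
  (cos t * p.1 - sin t * p.2, sin t * p.1 + cos t * p.2).

(* Main.v *)
Require Import Defs.
From mathcomp Require Import all_boot all_order all_algebra.
From mathcomp Require Import all_classical all_reals all_analysis.
From mathcomp Require wochoice.
From mathcomp Require Import lra ring.
Import Order.TTheory GRing.Theory Num.Theory.
Import numFieldNormedType.Exports.

Set Implicit Arguments.
Unset Strict Implicit.
Unset Printing Implicit Defensive.

Local Open Scope classical_set_scope.
Local Open Scope card_scope.
Local Open Scope ring_scope.

(* Every continuous partial function is contained in one of continuum many
   continuous partial functions G, each coded by a sequence of points. Fix G and
   an angle t. If the rotated line L meets G in a set whose projection is dense
   in some rational interval, then by continuity L is the only such line for
   that interval; so all but countably many lines meet the rotation of G in a
   nowhere dense set. Enumerate the lines and the pairs (t, G) along a well-order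
   all of whose initial segments have fewer than continuum many elements. At each
   step, complete the current line to two points, avoiding the earlier rotated
   graphs that it meets in a nowhere dense set, and the lines through two
   earlier points: these are fewer than continuum many nowhere dense subsets of
   the line, so cov(M) = c leaves room. A rotated graph then contains only points
   chosen before its index, and points on countably many exceptional lines. *)

(** * Cardinals *)

Lemma set_inj_card_le (T U : Type) (A : set T) (B : set U) (f : T -> U) :
  set_fun A B f -> set_inj A f -> A #<= B.
Proof.
move=> fAB finj; have [g] : $|{injfun A >-> B}| by apply/injfunPex; exists f.
exact: inj_card_le.
Qed.

Lemma card_le_set_inj (T U : Type) (A : set T) (B : set U) (u0 : U) :
  A #<= B -> exists2 f : T -> U, set_fun A B f & set_inj A f.
Proof.
move=> /card_leP[g]; apply/injfunPex.
by squash (valLR u0 g).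
Qed.

Lemma rel_card_le (T U : Type) (A : set T) (B : set U) (Z : T -> U -> Prop) :
  (forall x, A x -> exists2 y, B y & Z x y) ->
  (forall x x' y, Z x y -> Z x' y -> x = x') -> A #<= B.
Proof.
move=> ZAB Zinj; have [[x0 Ax0]|/nonemptyPn ->] := pselect (A !=set0); last first.
  exact: card_ge0.
have [y0 _ _] := ZAB _ Ax0.
have /choice[f fP] : forall x, exists y, A x -> B y /\ Z x y.
  move=> x; have [/ZAB[y By Zxy]|nAx] := pselect (A x); first by exists y.
  by exists y0.
apply: (@set_inj_card_le _ _ _ _ f) => [x /fP[]//|x x'].
rewrite !inE => /fP[_ Zx] /fP[_ Zx'] e; apply: Zinj Zx _.
by rewrite e.
Qed.

(** A maximal partial injection, given by Zorn's lemma, is total on [A] or onto [B]: otherwise a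
    pair of missed points would extend it. *)
Lemma card_le_total (T U : Type) (A : set T) (B : set U) :
  A #<= B \/ B #<= A.
Proof.
pose P (Z : set (T * U)) :=
  [/\ forall p, Z p -> A p.1 /\ B p.2,
      forall p q, Z p -> Z q -> p.1 = q.1 -> p.2 = q.2 &
      forall p q, Z p -> Z q -> p.2 = q.2 -> p.1 = q.1].
have [|Z [[ZAB Zfun Zinj] Zmax]] := @Zorn_bigcup _ P.
  move=> F FP Ftot; split.
  - by move=> p [Z /FP[+ _ _] Zp]; exact.
  - move=> p q [Z FZ Zp] [Z' FZ' Z'q].
    have [ZZ'|Z'Z] := Ftot _ _ FZ FZ'.
      by have [_ + _] := FP _ FZ'; apply => //; exact: ZZ'.
    by have [_ + _] := FP _ FZ; apply => //; exact: Z'Z.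
  - move=> p q [Z FZ Zp] [Z' FZ' Z'q].
    have [ZZ'|Z'Z] := Ftot _ _ FZ FZ'.
      by have [_ _] := FP _ FZ'; apply => //; exact: ZZ'.
    by have [_ _] := FP _ FZ; apply => //; exact: Z'Z.
have [domA|] := pselect (forall a, A a -> exists b, Z (a, b)).
  left; apply: (@rel_card_le _ _ _ _ (fun a b => Z (a, b))).
    by move=> a /domA[b Zab]; exists b => //; have [] := ZAB _ Zab.
  by move=> a a' b Zab Za'b; exact: (Zinj _ _ Zab Za'b).
move=> /existsNP[a /not_implyP[Aa /forallNP aZ]].
have [domB|] := pselect (forall b, B b -> exists a, Z (a, b)).
  right; apply: (@rel_card_le _ _ _ _ (fun b a => Z (a, b))).
    by move=> b /domB[a' Zab]; exists a' => //; have [] := ZAB _ Zab.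
  by move=> b b' a' Zab Za'b; exact: (Zfun _ _ Zab Za'b).
move=> /existsNP[b /not_implyP[Bb /forallNP bZ]].
exfalso; apply: (Zmax (Z `|` [set (a, b)])).
  split; first by move=> p Zp; left.
  by move=> /(_ (a, b)) /(_ (or_intror erefl)) /aZ.
split.
- by move=> p [/ZAB//|->].
- move=> [p1 p2] [q1 q2] [Zp|[-> ->]] [Zq|[-> ->]] //= e.
  + exact: (Zfun _ _ Zp Zq).
  + by rewrite e in Zp; case: (aZ p2).
  + by rewrite -e in Zq; case: (aZ q2).
- move=> [p1 p2] [q1 q2] [Zp|[-> ->]] [Zq|[-> ->]] //= e.
  + exact: (Zinj _ _ Zp Zq).
  + by rewrite e in Zp; case: (bZ p1).
  + by rewrite -e in Zq; case: (bZ q1).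
Qed.

Lemma card_leX (T U T' U' : Type) (A : set T) (B : set U) (A' : set T')
    (B' : set U') : A #<= A' -> B #<= B' -> A `*` B #<= A' `*` B'.
Proof.
have [[[x0 y0] [/= Ax0 By0]]|/nonemptyPn ->] := pselect (A `*` B !=set0); last first.
  by move=> _ _; exact: card_ge0.
move=> AA' BB'.
have [x0' _] : A' !=set0.
  by apply/set0P/eqP => A'0; move: AA'; rewrite A'0 => /card_le0P A0; rewrite A0 in Ax0.
have [y0' _] : B' !=set0.
  by apply/set0P/eqP => A'0; move: BB'; rewrite A'0 => /card_le0P A0; rewrite A0 in By0.
have [f fA finj] := card_le_set_inj x0' AA'.
have [g gA ginj] := card_le_set_inj y0' BB'.
apply: (@set_inj_card_le _ _ _ _ (fun p => (f p.1, g p.2))).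
  by move=> [x y] [/= /fA ? /gA].
move=> [x y] [x' y']; rewrite !inE /= => -[Ax By] [Ax' By'] [fe ge].
by congr pair; [apply: finj|apply: ginj]; rewrite ?inE.
Qed.

(* Elements of [U] are coded by their image in [X] together with a tag. *)
Lemma card_le_absorb (T : Type) (X U : set T) (c0 c1 : T) :
  X c0 -> X c1 -> c0 <> c1 -> X `*` X #<= X -> U `\` X #<= X -> U #<= X.
Proof.
move=> Xc0 Xc1 c01 /(card_le_set_inj c0)[phi phiX phiI].
move=> /(card_le_set_inj c0)[k kX kI].
pose e a := if pselect (X a) then phi (a, c0) else phi (k a, c1).
apply: (@set_inj_card_le _ _ _ _ e) => [a Ua|a b]; rewrite /e.
  case: pselect => [Xa|nXa]; first exact: phiX.
  by apply: phiX; split => //=; exact: kX.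
rewrite !inE => Ua Ub; case: pselect => Xa; case: pselect => Xb /phiI.
- by rewrite !inE /= => /(_ (conj Xa Xc0) (conj Xb Xc0)) [].
- by rewrite !inE /= => /(_ (conj Xa Xc0) (conj (kX _ (conj Ub Xb)) Xc1)) [_ /c01].
- rewrite !inE /= => /(_ (conj (kX _ (conj Ua Xa)) Xc1) (conj Xb Xc0)) [_ /esym].
  by move=> /c01.
- rewrite !inE /= => /(_ (conj (kX _ (conj Ua Xa)) Xc1)).
  move=> /(_ (conj (kX _ (conj Ub Xb)) Xc1)) [/kI]; apply; rewrite inE //.
Qed.

Lemma infinite_set_two (T : Type) (X : set T) :
  infinite_set X -> exists a b, [/\ X a, X b & a <> b].
Proof.
move=> Xinf; have [a Xa] := infinite_setN0 Xinf.
apply: contrapT => /forallNP/(_ a)/forallNP Xa1; apply: Xinf.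
suff -> : X = [set a] by exact: finite_set1.
apply/seteqP; split => [b Xb|b ->//] /=.
by apply: contrapT => ba; apply: (Xa1 b); split => // ab; apply: ba.
Qed.

(* Zorn's lemma on sets of the form [inl @` X `|` inr @` Z] with [Z] the graph
   of an injection of [X `*` X] into [X]. *)
Lemma card_square_le (T : Type) (A : set T) :
  infinite_set A -> A `*` A #<= A.
Proof.
move=> Ainf.
(* [inl x] puts [x] into [X], and [inr (x, y, z)] sends the pair [(x, y)] to [z]. The last clause
   spares the empty set, which is the union of the empty chain. *)
pose P (S : set (T + T * T * T)) :=
  [/\ forall x, S (inl x) -> A x,
      forall x y, S (inl x) -> S (inl y) ->
        exists2 z, S (inl z) & S (inr (x, y, z)),
      forall x y z, S (inr (x, y, z)) -> [/\ S (inl x), S (inl y) & S (inl z)],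
      forall p q z, S (inr (p, z)) -> S (inr (q, z)) -> p = q &
      S !=set0 -> infinite_set [set x | S (inl x)]].
have [|S [[SA Sdom Srng Sinj Sinf] Smax]] := @Zorn_bigcup _ P.
  move=> F FP Ftot; split.
  - by move=> x [S /FP[+ _ _ _ _] Sx]; exact.
  - move=> x y [S FS Sx] [S' FS' S'y].
    have [SS'|S'S] := Ftot _ _ FS FS'.
      have [_ + _ _ _] := FP _ FS' => /(_ x y (SS' _ Sx) S'y)[z].
      by exists z; exists S'.
    have [_ + _ _ _] := FP _ FS => /(_ x y Sx (S'S _ S'y))[z].
    by exists z; exists S.
  - move=> x y z [S FS Sxyz]; have [_ _ + _ _] := FP _ FS => /(_ _ _ _ Sxyz)[].
    by move=> *; split; exists S.
  - move=> p q z [S FS Sx] [S' FS' S'y].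
    have [SS'|S'S] := Ftot _ _ FS FS'.
      by have [_ _ _ + _] := FP _ FS'; apply; [exact: SS' Sx|].
    by have [_ _ _ + _] := FP _ FS; apply; [|exact: S'S S'y].
  - move=> [s [S FS Ss]].
    have [_ _ _ _ /(_ (ex_intro _ s Ss))] := FP _ FS.
    by apply: sub_infinite_set => x Sx; exists S.
(* The maximal [S] is nonempty: a copy of [nat] in [A], with [pickle] as pairing function, extends
   the empty set. *)
have [S0|S0] := pselect (S !=set0); last first.
  have [t0 _] := infinite_setN0 Ainf.
  have /infiniteP/(card_le_set_inj t0)[h hA hI] := Ainf.
  have hII i j : h i = h j -> i = j by apply: hI; rewrite inE.
  have hinf : infinite_set (h @` setT).
    apply/infiniteP; exact: (@set_inj_card_le _ _ _ _ h).
  exfalso; apply: (Smax (fun s => match s with inl x => (h @` setT) x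
     | inr (x, y, z) => exists i j,
       [/\ x = h i, y = h j & z = h (pickle (i, j))] end)).
    split; first by move=> s Ss; case: S0; exists s.
    move=> /(_ (inl (h 0%N))) /= sub; apply: S0; exists (inl (h 0%N)).
    by apply: sub; exists 0%N.
  split => /=.
  - by move=> _ [i _ <-]; exact: hA.
  - move=> _ _ [i _ <-] [j _ <-]; exists (h (pickle (i, j))).
      by exists (pickle (i, j)).
    by exists i, j.
  - by move=> x y z [i [j [-> -> ->]]]; split; eexists.
  - move=> [a b] [c d] z [i [j [-> -> ->]]] [i' [j' [-> -> /hII]]].
    by move=> /(pcan_inj pickleK)[-> ->].
  - by [].
move/(_ S0) in Sinf.
set X := [set x | S (inl x)] in Sinf.
have XX : X `*` X #<= X.
  apply: (@rel_card_le _ _ _ _ (fun p z => S (inr (p, z)))).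
    by move=> [x y] [/= Xx Xy]; have [z] := Sdom _ _ Xx Xy; exists z.
  by move=> p q z; exact: Sinj.
have [c0 [c1 [Xc0 Xc1 c01]]] := infinite_set_two Sinf.
have [AX|XA] := card_le_total (A `\` X) X.
  have {}AX : A #<= X by exact: card_le_absorb Xc0 Xc1 c01 XX AX.
  apply: (card_le_trans (card_leX AX AX)).
  by apply: (card_le_trans XX); exact: (@subset_card_le _ X A).
(* Otherwise the rest of [A] contains a copy of [X], its image under [h]. The pairs from [X'] that
   are not pairs from [X] can be sent into this copy, away from the old values, which contradicts
   maximality. *)
have [h hA hI] := card_le_set_inj c0 XA.
pose X' := X `|` h @` X.
have X'X : X' #<= X.
  apply: (card_le_absorb Xc0 Xc1 c01 XX).
  apply: (card_le_trans _ (card_image_le h X)); apply: subset_card_le.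
  by move=> x [[]].
have XY : X #<= h @` X by exact: (@set_inj_card_le _ _ _ _ h).
have := card_le_trans (card_leX X'X X'X) (card_le_trans XX XY).
move=> /(card_le_set_inj c0)[psi psiY psiI].
have YA y : (h @` X) y -> A y /\ ~ X y by move=> [x /hA[? ?] <-].
exfalso; apply: (Smax (fun s => match s with inl x => X' x
     | inr (p, z) => S (inr (p, z)) \/ [/\ (X' `*` X') p, ~ (X `*` X) p & z = psi p]
     end)).
  split; first by case=> [x|[p z]] Ss; left.
  move=> /(_ (inl (h c0))) /= sub.
  have hc0 : (h @` X) (h c0) by exists c0.
  by have [_] := YA _ hc0; apply; apply: sub; right.
split => //=.
- by move=> x [/SA//|/YA[]].
- move=> x y X'x X'y; have [[Xx Xy]|nXX] := pselect ((X `*` X) (x, y)).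
    by have [z ? ?] := Sdom _ _ Xx Xy; exists z; left.
  exists (psi (x, y)); last by right.
  by right; apply: psiY.
- move=> x y z [/Srng[? ? ?]|[[? ?] _ ->]]; first by split; left.
  by split=> //; right; apply: psiY.
- move=> [x y] [x' y'] z [Sp|[X'p nXp zp]] [Sq|[X'q nXq zq]].
  + exact: Sinj Sp Sq.
  + have [_ _ Xz] := Srng _ _ _ Sp.
    by have [_] := YA _ (psiY _ X'q); rewrite -zq.
  + have [_ _ Xz] := Srng _ _ _ Sq.
    by have [_] := YA _ (psiY _ X'p); rewrite -zp.
  + by apply: psiI; rewrite ?inE // -zp.
- by move=> _; apply: sub_infinite_set Sinf => x; left.
Qed.

(** * Well-orders and transfinite recursion *)

Definition strict_well_order (T : Type) (lt : T -> T -> Prop) : Prop :=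
  [/\ well_founded lt, forall x y z, lt x y -> lt y z -> lt x z &
      forall x y, [\/ lt x y, x = y | lt y x]].

Lemma strict_well_order_exists (T : Type) :
  exists lt : T -> T -> Prop, strict_well_order lt.
Proof.
elim/Peq: T => T; have [le le_wo] := wochoice.well_ordering_principle T.
have le_chain : wochoice.wo_chain le predT by move=> A _; exact: le_wo.
have le_anti x y : le x y -> le y x -> x = y.
  move=> xy yx; apply: (wochoice.wo_chain_antisymmetric le_chain) => //.
  by rewrite xy yx.
have le_tot x y : le x y || le y x by exact: (wochoice.wo_chainW le_chain).
exists (fun x y => le x y /\ x <> y); split.
- move=> x; apply: contrapT => nAx.
  have [|z [[zA zmin] _]] := le_wo (fun x => `[< ~ Acc (fun x y => le x y /\ x <> y) x >]).
    by exists x; apply/asboolP.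
  move/asboolP: zA; apply; constructor => y [yz nyz]; apply: contrapT => nAy.
  by apply: nyz; apply: le_anti => //; apply: zmin; apply/asboolP.
- move=> x y z [xy nxy] [yz nyz].
  (* Transitivity comes from the least of [x], [y], [z]: if it is [y] or [z], antisymmetry
     contradicts [x <> y] or [y <> z]. *)
  have [|w [[wA wmin] _]] := le_wo [pred w | [|| w == x, w == y | w == z]].
    by exists x; rewrite inE /= eqxx.
  have [wx wy wz] : [/\ le w x, le w y & le w z].
    by split; apply: wmin; rewrite inE /= eqxx ?orbT.
  move: wA; rewrite inE /= => /or3P[] /eqP we; subst w.
  + by split => // xz; subst z; exact/nxy/le_anti.
  + by case: nxy; exact: le_anti.
  + by case: nyz; exact: le_anti.
- move=> x y; have [->|nxy] := pselect (x = y); first exact: Or32.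
  have /orP[xy|yx] := le_tot x y; first exact: Or31.
  by apply: Or33; split => // e; apply: nxy.
Qed.

(* Transport the order along an injection of [T] into the least initial segment
   as large as [T]. *)
Lemma initial_well_order (T : Type) :
  exists2 lt : T -> T -> Prop, strict_well_order lt &
    forall x, ~ ([set: T] #<= [set y | lt y x]).
Proof.
have [lt [lt_wf lt_trans lt_tot]] := strict_well_order_exists T.
have [small|] := pselect (forall x, ~ ([set: T] #<= [set y | lt y x])).
  by exists lt.
(* Induction along [lt] reduces to the least [x0] whose initial segment is as large as [T]. *)
move=> /existsNP[x0]; have := lt_wf x0; elim=> {}x0 _ IH /contrapT Tx0.
have [[y yx0 Ty]|/forall2NP min] := pselect (exists2 y, lt y x0 &
    ([set: T] #<= [set z | lt z y])).
  by apply: (IH y yx0); apply.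
have [h hx0 hI] := card_le_set_inj x0 Tx0.
have hII a b : h a = h b -> a = b by apply: hI; rewrite inE.
exists (fun a b => lt (h a) (h b)).
  split => [a|a b c|a b].
  - suff wf z : Acc lt z -> forall b, h b = z ->
        Acc (fun a b => lt (h a) (h b)) b by exact: wf (lt_wf (h a)) _ erefl.
    elim=> {}z _ IHz b bz; constructor => c; rewrite bz => cz.
    exact: IHz cz c erefl.
  - exact: lt_trans.
  - by case: (lt_tot (h a) (h b)) => [?|/hII ?|?]; [apply: Or31|apply: Or32|apply: Or33].
(* [h a] lies below [x0], so by minimality its initial segment is not as large as [T]. *)
move=> a Ta; have [/(_ (hx0 a I))//|] := min (h a); apply.
apply: (card_le_trans Ta); apply: (@set_inj_card_le _ _ _ _ h) => // b c _ _.
exact: hII.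
Qed.

(** Transfinite recursion with a choice at each stage. [Q x f v] depends on [f] only below [x], and
    a value has to exist only when the earlier ones are correct; [step] falls back on [v0]
    otherwise. *)
Lemma wf_choice (T : Type) (V : choiceType) (lt : T -> T -> Prop)
    (Q : T -> (T -> V) -> V -> Prop) (v0 : V) :
  well_founded lt ->
  (forall x f g v, (forall y, lt y x -> f y = g y) -> Q x f v -> Q x g v) ->
  (forall x f, (forall y, lt y x -> Q y f (f y)) -> exists v, Q x f v) ->
  exists f, forall x, Q x f (f x).
Proof.
move=> lt_wf Qext Qex.
pose ext x (h : forall y, lt y x -> V) y :=
  if pselect (lt y x) is left yx then h y yx else v0.
pose step x h := xget v0 (Q x (ext x h)).
pose f := Fix lt_wf (fun _ => V) step.
have fE x : f x = step x (fun y _ => f y).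
  apply: (Fix_eq lt_wf (fun _ => V) step) => y g g' gg'; congr (step y).
  apply: functional_extensionality_dep => z.
  by apply: functional_extensionality_dep => zy; exact: gg'.
exists f => x; have := lt_wf x; elim=> {}x _ IH.
have extE y : lt y x -> ext x (fun y _ => f y) y = f y.
  by move=> yx; rewrite /ext; case: pselect.
have [v Qv] := Qex x f IH.
apply: (Qext x (ext x (fun y _ => f y))) => //; rewrite fE /step.
apply: (@xgetI _ v0 _ v); apply: (Qext x f) => // y yx.
by rewrite extE.
Qed.

(** * Binary sequences and the reals *)

Section CantorSeries.
Variable R : realType.
Implicit Types b c : nat -> bool.

Let psum b n : R := \sum_(i < n) (b i)%:R * 3^-1 ^+ i.

Let psumS b n : psum b n.+1 = psum b n + (b n)%:R * 3^-1 ^+ n.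
Proof. by rewrite /psum big_ord_recr. Qed.

(** The bound is the geometric sum obtained when all digits from [m] to [m + k - 1] are 1. *)
Let psum_tail b m k :
  psum b (m + k) <= psum b m + 3 / 2 * (3^-1 ^+ m - 3^-1 ^+ (m + k)).
Proof.
elim: k => [|k IH]; first by rewrite addn0 subrr mulr0 addr0.
rewrite addnS psumS exprS.
have : (0 : R) <= 3^-1 ^+ (m + k) by rewrite exprn_ge0.
by case: (b _) => /= ?; lra.
Qed.

Let psum_le b m n : psum b n <= psum b m + 3 / 2 * 3^-1 ^+ m.
Proof.
have pos k : (0 : R) <= 3^-1 ^+ k by rewrite exprn_ge0.
have [mn|nm] := leqP m n.
  have := psum_tail b m (n - m); rewrite subnKC // => /le_trans; apply.
  by have := pos n; lra.
suff : psum b n <= psum b m by have := pos m; lra.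
rewrite -(subnKC (ltnW nm)); elim: (m - n)%N => [|k]; first by rewrite addn0.
rewrite addnS psumS; have := pos (n + k)%N.
by case: (b _) => /= ? ?; lra.
Qed.

Definition cantor_real b : R := sup (range (psum b)).

Let cantor_real_bounds b m :
  psum b m <= cantor_real b <= psum b m + 3 / 2 * 3^-1 ^+ m.
Proof.
have ub n : ubound (range (psum b)) (psum b n + 3 / 2 * 3^-1 ^+ n).
  by move=> _ [k _ <-]; exact: psum_le.
apply/andP; split; last by apply: ge_sup => //; exists (psum b 0), 0%N.
by apply: ub_le_sup; [exists (psum b 0 + 3 / 2 * 3^-1 ^+ 0)|exists m].
Qed.

(** At the first difference [m] the larger digit gains [3^-m], while all later digits together
    contribute at most half of that. *)
Lemma cantor_real_inj : injective cantor_real.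
Proof.
suff lt b c m : (forall i, (i < m)%N -> b i = c i) -> b m = true ->
    c m = false -> cantor_real c < cantor_real b.
  move=> b c bc; apply/funext => n; apply: contrapT => bcn.
  have exn : exists n, b n != c n by exists n; apply/eqP.
  case: (ex_minnP exn) => m bcm mmin.
  have agree i : (i < m)%N -> b i = c i.
    by move=> im; apply/eqP; apply: contraTT im => /mmin; rewrite -leqNgt.
  move: bcm; case bm: (b m); case cm: (c m) => // _.
    by have := lt b c m agree bm cm; rewrite bc ltxx.
  by have := lt c b m (fun i im => esym (agree i im)) cm bm; rewrite bc ltxx.
move=> agree bm cm.
have /andP[+ _] := cantor_real_bounds b m.+1.
have /andP[_ +] := cantor_real_bounds c m.+1.
have -> : psum b m.+1 = psum c m.+1 + 3^-1 ^+ m.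
  rewrite !psumS bm cm mul0r addr0 mul1r; congr (_ + _).
  by apply: eq_bigr => i _; rewrite agree.
have : (0 : R) < 3^-1 ^+ m by rewrite exprn_gt0.
by rewrite exprS => ? ? ?; lra.
Qed.

End CantorSeries.

(** The entries are determined by their rational lower cuts, which together form one binary sequence
    indexed by codes of triples [(i, j, q)]. *)
Lemma card_seq2_le_real (R : realType) : [set: nat -> nat -> R] #<= [set: R].
Proof.
pose cut (x : nat -> nat -> R) n :=
  if unpickle n is Some (i, j, q) then ratr (q : rat) < x i j else false.
apply: (@set_inj_card_le _ _ _ _ (@cantor_real R \o cut)) => // x y _ _ /=.
move=> /cantor_real_inj xy; apply/funext => i; apply/funext => j.
have {}xy q : (ratr q < x i j) = (ratr q < y i j).
  by have := congr1 (@^~ (pickle (i, j, q))) xy; rewrite /cut pickleK.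
have [/rat_in_itvoo[q]|/rat_in_itvoo[q]|//] := ltgtP (x i j) (y i j);
  rewrite in_itv /= => /andP[q1 q2]; have := xy q.
  by rewrite q2 ltNge (ltW q1).
by rewrite q2 [RHS]ltNge (ltW q1).
Qed.

(** Cantor's diagonal argument for binary sequences, which [cantor_real] embeds in the reals. *)
Lemma uncountable_real (R : realType) : ~ countable [set: R].
Proof.
move=> Rc.
have /(card_le_set_inj 0%N)[g _ gI] : [set: nat -> bool] #<= [set: nat].
  apply: card_le_trans Rc; apply: (@set_inj_card_le _ _ _ _ (@cantor_real R)) => //.
  by move=> b c _ _ /cantor_real_inj.
have /choice[d dP] n : exists c : nat -> bool, forall b, g b = n -> b = c.
  have [[c cn]|/forallNP no] := pselect (exists c, g c = n).
    by exists c => b bn; apply: gI; rewrite ?inE // bn.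
  by exists xpred0 => b /no.
pose b n := ~~ d n n.
have /(congr1 (@^~ (g b))) := dP (g b) b erefl.
by rewrite /b; case: (d _ _).
Qed.

(** * Sets of fewer than continuum many elements *)

Definition small (R : realType) (U : Type) (A : set U) : Prop :=
  ~ ([set: R] #<= A).

Section Small.
Variable R : realType.

Lemma small_card_le (T U : Type) (A : set T) (B : set U) :
  A #<= B -> small R B -> small R A.
Proof. by move=> AB; apply: contra_not => /card_le_trans; apply. Qed.

Lemma small_card_lt (T : Type) (A : set T) : small R A -> card_lt A [set: R].
Proof. by move=> As; split => //; case: (card_le_total A [set: R]). Qed.

Lemma small_subset (T : Type) (A B : set T) : A `<=` B -> small R B -> small R A.
Proof. by move=> /subset_card_le; exact: small_card_le. Qed.

Lemma small_image (T U : Type) (f : T -> U) (A : set T) :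
  small R A -> small R (f @` A).
Proof. exact: small_card_le (card_image_le f A). Qed.

Lemma countable_small (T : Type) (A : set T) : countable A -> small R A.
Proof. by move=> Ac /card_le_trans/(_ Ac); exact: uncountable_real. Qed.

(** The product injects into the square of the larger factor, which is countable or no larger than
    that factor. *)
Lemma small_setX (T U : Type) (A : set T) (B : set U) :
  small R A -> small R B -> small R (A `*` B).
Proof.
have sq (V : Type) (C : set V) : small R C -> small R (C `*` C).
  move=> Cs; have [Cfin|Cinf] := pselect (finite_set C).
    by apply: countable_small; apply: countableX; exact: finite_set_countable.
  exact: small_card_le (card_square_le Cinf) Cs.
move=> As Bs; have [AB|BA] := card_le_total A B.
  by apply: (small_card_le (card_leX AB (card_lexx B))); exact: sq.
by apply: (small_card_le (card_leX (card_lexx A) BA)); exact: sq.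
Qed.

(** The union injects into the product of the larger set with [bool]. *)
Lemma small_setU (T : Type) (A B : set T) :
  small R A -> small R B -> small R (A `|` B).
Proof.
wlog AB : A B / A #<= B.
  move=> wl As Bs; have [AB|BA] := card_le_total A B; first exact: wl.
  by rewrite setUC; exact: wl.
move=> As Bs; have [[b0 Bb0]|/nonemptyPn B0] := pselect (B !=set0); last first.
  by rewrite B0 setU0.
have [f fB fI] := card_le_set_inj b0 AB.
have bool_s : small R [set: bool] by exact/countable_small/countableP.
apply: (small_card_le _ (small_setX Bs bool_s)).
apply: (@rel_card_le _ _ _ _ (fun x p =>
  if p.2 then x = p.1 else A x /\ f x = p.1)).
  move=> x [Ax|Bx]; last by exists (x, true).
  by exists (f x, false) => //; split => //; exact: fB.
move=> x x' [y []] /=; first by move=> -> ->.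
by move=> [Ax <-] [Ax' /fI ->] //; rewrite inE.
Qed.

End Small.

(** * Lines and continuous partial functions *)

Section Lines.
Variable R : realType.
Implicit Types (p q r : R * R) (L : set (R * R)).

Lemma line_unique L L' p q : is_line L -> is_line L' -> p <> q ->
  L p -> L q -> L' p -> L' q -> L = L'.
Proof.
suff sub a b c a' b' c' : (a, b) <> (0, 0) -> p <> q ->
    a * p.1 + b * p.2 = c -> a * q.1 + b * q.2 = c ->
    a' * p.1 + b' * p.2 = c' -> a' * q.1 + b' * q.2 = c' ->
    [set r : R * R | a * r.1 + b * r.2 = c]
    `<=` [set r : R * R | a' * r.1 + b' * r.2 = c'].
  move=> [a [b [c [ab ->]]]] [a' [b' [c' [ab' ->]]]] pq Lp Lq L'p L'q.
  by apply/seteqP; split; apply: sub.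
move=> ab pq Lp Lq L'p L'q [x y] /= Lr.
(* Vectors orthogonal to the nonzero [(a, b)] are parallel. *)
have par (u v u' v' : R) : a * u + b * v = 0 -> a * u' + b * v' = 0 ->
    u * v' = u' * v.
  move=> e e'; have [a0|a0] := eqVneq a 0.
    have b0 : b != 0 by apply/eqP => b0; apply: ab; rewrite a0 b0.
    move: e e'; rewrite a0 !mul0r !add0r => /eqP + /eqP.
    by rewrite !mulf_eq0 (negbTE b0) /= => /eqP -> /eqP ->; rewrite !mulr0.
  have {}e : a * u = - (b * v) by lra.
  have {}e' : a * u' = - (b * v') by lra.
  by apply: (mulfI a0); rewrite !mulrA e e'; ring.
have E1 := par (q.1 - p.1) (q.2 - p.2) (x - p.1) (y - p.2) ltac:(lra) ltac:(lra).
have E2 : a' * (q.1 - p.1) + b' * (q.2 - p.2) = 0 by lra.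
have dd : q.1 - p.1 = 0 -> q.2 - p.2 != 0.
  move=> d1; apply/eqP => d2; apply: pq.
  by rewrite (surjective_pairing p) (surjective_pairing q); congr pair; lra.
suff : a' * (x - p.1) + b' * (y - p.2) = 0 by lra.
move: (q.1 - p.1) (q.2 - p.2) (x - p.1) (y - p.2) E1 E2 dd => d1 d2 x1 y1 E1 E2 dd.
have [d10|d10] := eqVneq d1 0.
  apply: (mulfI (dd d10)).
  have -> : d2 * (a' * x1 + b' * y1) =
    y1 * (a' * d1 + b' * d2) - a' * (d1 * y1 - x1 * d2) by ring.
  by rewrite E1 E2 subrr !mulr0 subrr.
apply: (mulfI d10).
have -> : d1 * (a' * x1 + b' * y1) =
  x1 * (a' * d1 + b' * d2) + b' * (d1 * y1 - x1 * d2) by ring.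
by rewrite E1 E2 subrr !mulr0 addr0.
Qed.

Definition line_point (p0 d : R * R) (u : R) : R * R :=
  (p0.1 + u * d.1, p0.2 + u * d.2).

Lemma line_point_inj p0 d : d <> (0, 0) -> injective (line_point p0 d).
Proof.
case: d => d1 d2 d0 u v [/addrI /= e1 /addrI e2].
have [d10|/mulIf] := eqVneq d1 0; last exact.
have [d20|/mulIf] := eqVneq d2 0; last exact.
by case: d0; rewrite d10 d20.
Qed.

Lemma line_parametrization L : is_line L ->
  exists p0 d, d <> (0, 0) /\ forall u, L (line_point p0 d u).
Proof.
move=> [a [b [c [ab ->]]]].
(* The foot of the perpendicular from the origin, and a direction orthogonal to the normal. *)
exists (a * c / (a ^+ 2 + b ^+ 2), b * c / (a ^+ 2 + b ^+ 2)), (- b, a); split.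
  by move=> [/eqP]; rewrite oppr_eq0 => /eqP b0 a0; apply: ab; rewrite a0 b0.
move=> u /=; have ab2 : a ^+ 2 + b ^+ 2 != 0.
  rewrite paddr_eq0 ?sqr_ge0 // !sqrf_eq0; apply/negP => /andP[/eqP a0 /eqP b0].
  by apply: ab; rewrite a0 b0.
by field.
Qed.

Lemma somewhere_dense (E : set R) : ~ nowhere_dense E ->
  exists u0 e, 0 < e /\ forall u, `|u - u0| < e ->
    forall d, 0 < d -> exists2 v, E v & `|v - u| < d.
Proof.
move=> /eqP/set0P[u0 /nbhs_ballP[e /= e0 sub]].
exists u0, e; split => // u uu0 d d0.
have /sub : ball u0 e u by rewrite /ball /= distrC.
by move=> /(_ _ (nbhsx_ballx u d d0))[v [Ev]]; exists v => //; rewrite distrC.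
Qed.

Lemma subsingleton_nowhere_dense (E : set R) :
  (forall u v, E u -> E v -> u = v) -> nowhere_dense E.
Proof.
move=> E1; apply: contrapT => /somewhere_dense[u0 [e [e0 dense]]].
have e4 : 0 < e / 4 by lra.
have [|v Ev vu] := dense (u0 - e / 2) _ (e / 4) e4.
  by rewrite ltr_norml; lra.
have [|w Ew wu] := dense (u0 + e / 2) _ (e / 4) e4.
  by rewrite ltr_norml; lra.
move: vu wu; rewrite (E1 _ _ Ew Ev) !ltr_norml => /andP[? ?] /andP[? ?].
by lra.
Qed.

Lemma nowhere_dense_meager (E : set R) : nowhere_dense E -> meager E.
Proof.
by move=> E0; exists (fun=> E); split => //; rewrite bigcup_const //; exists 0%N.
Qed.

End Lines.

(** * Limit graphs and the lines that meet them densely *)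

Section Closure.
Variable R : realType.
Implicit Types (p q : R * R) (s : nat -> R * R) (L : set (R * R)).

(* It contains the graph of every continuous partial function [f] such that [s]
   enumerates points of the graph of [f] whose abscissas are dense in its domain. *)
Definition limit_graph s : set (R * R) := [set p |
  (forall e, 0 < e -> exists2 d, 0 < d &
     forall n, `|(s n).1 - p.1| < d -> `|(s n).2 - p.2| < e) /\
  (forall d, 0 < d -> exists n, `|(s n).1 - p.1| < d)].

(** Some [s n] has its abscissa close to those of both [p] and [q], hence its ordinate within
    [e / 2] of both ordinates. *)
Lemma limit_graph_continuous s p : limit_graph s p ->
  forall e, 0 < e -> exists2 d, 0 < d &
    forall q, limit_graph s q -> `|q.1 - p.1| < d -> `|q.2 - p.2| < e.
Proof.
move=> [pc _] e e0; have e2 : 0 < e / 2 by lra.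
have [d d0 dP] := pc _ e2; exists (d / 2); first by lra.
move=> q [/(_ _ e2)[d' d'0 d'P] qd] qp.
have d''0 : 0 < Num.min d' (d / 2) by rewrite lt_min d'0; lra.
have [n] := qd _ d''0; rewrite lt_min => /andP[/d'P n1 n2].
have := dP n; rewrite !ltr_norml in n1 n2 qp *.
have -> : - d < (s n).1 - p.1 < d by move: n2 qp => /andP[? ?] /andP[? ?]; lra.
by move=> /(_ isT); move: n1 => /andP[? ?] /andP[? ?]; lra.
Qed.

Lemma limit_graph_functional s p q :
  limit_graph s p -> limit_graph s q -> p.1 = q.1 -> p = q.
Proof.
move=> Gp Gq pq; rewrite [p]surjective_pairing [q]surjective_pairing pq.
congr pair; apply/eqP; rewrite -subr_eq0 -normr_le0 leNgt; apply/negP => e0.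
have [d d0 /(_ p Gp)] := limit_graph_continuous Gq e0.
by rewrite pq subrr normr0 ltxx => /(_ d0).
Qed.

Lemma rotation_inv (t : R) p :
  p = (cos t * (rotation t p).1 + sin t * (rotation t p).2,
       cos t * (rotation t p).2 - sin t * (rotation t p).1).
Proof.
have cs := cos2Dsin2 t.
rewrite [p in LHS]surjective_pairing /=; congr pair.
  by rewrite -[LHS]mul1r -cs; ring.
by rewrite -[LHS]mul1r -cs; ring.
Qed.

Lemma rotation_inj (t : R) : injective (rotation t).
Proof. by move=> p q e; rewrite (rotation_inv t p) (rotation_inv t q) e. Qed.

Lemma cos_norm_le1 (t : R) : `|cos t| <= 1.
Proof. by rewrite ler_norml cos_geN1 cos_le1. Qed.

Lemma sin_norm_le1 (t : R) : `|sin t| <= 1.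
Proof. by rewrite ler_norml sin_geN1 sin_le1. Qed.

(** Rational endpoints leave countably many intervals, hence countably many exceptional lines for
    given [t] and [s]. *)
Definition meets_densely (t : R) s L (r : rat * rat) : Prop :=
  ratr r.1 < ratr r.2 :> R /\
  forall x : R, ratr r.1 < x < ratr r.2 -> forall e, 0 < e ->
    exists2 p, L p /\ limit_graph s (rotation t p) & `|(rotation t p).1 - x| < e.

(** Points [q] of [L] have rotations on the graph with abscissas close to that of [p]. By continuity
    the ordinates are close too; rotating back, [q] is close to [p], and [L] is closed. *)
Lemma meets_densely_closed t s L r p : is_line L -> meets_densely t s L r ->
  limit_graph s (rotation t p) -> ratr r.1 < (rotation t p).1 < ratr r.2 -> L p.
Proof.
move=> [a [b [c [_ ->]]]] [_ Ld] Gp pr /=.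
apply/eqP; rewrite -subr_eq0 -normr_le0; apply/ler_addgt0Pl => e e0.
(* If [q] is within [e / K] of [p] in each coordinate, the equation of [L] fails at [p] by at most
   [e]; the summand 1 keeps [K] positive. *)
rewrite addr0; set K := `|a| + `|b| + 1.
have K0 : 0 < K by rewrite /K; have := normr_ge0 a; have := normr_ge0 b; lra.
have e' : 0 < e / K / 2 by rewrite !divr_gt0.
have [d d0 dP] := limit_graph_continuous Gp e'.
have m0 : 0 < Num.min d (e / K / 2) by rewrite lt_min d0.
have [q [/= qL Gq]] := Ld _ pr _ m0; rewrite lt_min => /andP[/(dP _ Gq) q2 q1].
have near (x y : R) : `|x| <= 1 -> `|y| <= 1 ->
   `|x * ((rotation t q).1 - (rotation t p).1) +
     y * ((rotation t q).2 - (rotation t p).2)| <= e / K.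
  move=> x1 y1; apply: (le_trans (ler_normD _ _)); rewrite !normrM.
  rewrite [leRHS]splitr; apply: lerD.
    by apply: (le_trans _ (ltW q1)); rewrite ler_piMl.
  by apply: (le_trans _ (ltW q2)); rewrite ler_piMl.
have n1 : `|q.1 - p.1| <= e / K.
  have := near (cos t) (sin t) (cos_norm_le1 t) (sin_norm_le1 t).
  rewrite [in `|q.1 - p.1|](rotation_inv t q) [in `|_ - p.1|](rotation_inv t p).
  move: (rotation t p) (rotation t q) => P Q /=.
  by congr (`| _ | <= _); ring.
have n2 : `|q.2 - p.2| <= e / K.
  have := near (- sin t) (cos t) _ (cos_norm_le1 t).
  rewrite normrN => /(_ (sin_norm_le1 t)).
  rewrite [in `|q.2 - p.2|](rotation_inv t q) [in `|_ - p.2|](rotation_inv t p).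
  move: (rotation t p) (rotation t q) => P Q /=.
  by congr (`| _ | <= _); ring.
have -> : a * p.1 + b * p.2 - c = - (a * (q.1 - p.1) + b * (q.2 - p.2)).
  by rewrite -qL; ring.
rewrite normrN; apply: (le_trans (ler_normD _ _)); rewrite !normrM.
have : `|a| * `|q.1 - p.1| + `|b| * `|q.2 - p.2| <= `|a| * (e / K) + `|b| * (e / K).
  by apply: lerD; rewrite ler_wpM2l.
move=> /le_trans; apply; rewrite -mulrDl mulrC -mulrA ler_piMr ?(ltW e0) //.
by rewrite mulrC ler_pdivrMr // /K; lra.
Qed.

Lemma meets_densely_unique t s L L' r : is_line L -> is_line L' ->
  meets_densely t s L r -> meets_densely t s L' r -> L = L'.
Proof.
move=> lL lL' mL mL'; have [r12 L'd] := mL'.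
pose r1 : R := ratr r.1; pose r2 : R := ratr r.2.
(* Two points of [L'] are taken over abscissas within an eighth of the length from the quarter point
   and the midpoint: these are distinct and inside the interval, so both points lie on [L] as
   well. *)
have e0 : 0 < (r2 - r1) / 8 by rewrite divr_gt0 // subr_gt0.
have e0' : 0 < r2 - r1 by rewrite subr_gt0.
have [|p [L'p Gp] pr] := L'd (r1 + (r2 - r1) / 4) _ _ e0.
  by rewrite -/r1 -/r2; lra.
have [|q [L'q Gq] qr] := L'd (r1 + (r2 - r1) / 2) _ _ e0.
  by rewrite -/r1 -/r2; lra.
move: pr qr; rewrite !ltr_norml => /andP[? ?] /andP[? ?].
have pq : p <> q by move=> e; subst q; lra.
apply: (line_unique lL lL' pq) => //.
  by apply: meets_densely_closed lL mL Gp _; rewrite -/r1 -/r2; lra.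
by apply: meets_densely_closed lL mL Gq _; rewrite -/r1 -/r2; lra.
Qed.

(** The rotated abscissa is affine in [u]. If its slope is zero, the rotated line is vertical and
    meets the graph at most once. Otherwise an interval of parameters where the set is dense would
    map onto an interval of abscissas, which contains a rational one. *)
Lemma not_meets_densely_nowhere_dense t s L p0 d : d <> (0, 0) ->
  (forall u, L (line_point p0 d u)) -> (forall r, ~ meets_densely t s L r) ->
  nowhere_dense [set u | limit_graph s (rotation t (line_point p0 d u))].
Proof.
move=> d0 Lp nL; set E := [set u | _].
have Xu u : (rotation t (line_point p0 d u)).1 =
  (rotation t p0).1 + u * (rotation t d).1 by rewrite /rotation /=; ring.
have [dX|dX] := eqVneq (rotation t d).1 0.
  apply: subsingleton_nowhere_dense => u v Eu Ev.
  apply: (line_point_inj d0); apply: (@rotation_inj t).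
  by apply: limit_graph_functional Eu Ev _; rewrite !Xu dX !mulr0.
apply: contrapT => /somewhere_dense[u0 [e [e0 dense]]].
set D := (rotation t d).1 in Xu dX.
have D0 : 0 < `|D| by rewrite normr_gt0.
set x0 := (rotation t (line_point p0 d u0)).1.
have eD : 0 < e * `|D| by rewrite mulr_gt0.
have [|r1] := @rat_in_itvoo R (x0 - e * `|D|) x0 _; first by lra.
have [|r2] := @rat_in_itvoo R x0 (x0 + e * `|D|) _; first by lra.
rewrite !in_itv /= => /andP[r2l r2r] /andP[r1l r1r].
apply: (nL (r1, r2)); split => /=; first by lra.
move=> x /andP[xl xr] f f0.
have [|v Ev vu] := dense (u0 + (x - x0) / D) _ (f / `|D|) (divr_gt0 f0 D0).
  rewrite addrC addKr normrM normfV ltr_pdivrMr // ltr_norml.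
  by apply/andP; split; lra.
exists (line_point p0 d v) => //.
have -> : (rotation t (line_point p0 d v)).1 - x = (v - (u0 + (x - x0) / D)) * D.
  rewrite mulrBl mulrDl divfK // /x0 !Xu; ring.
by rewrite normrM -ltr_pdivlMr.
Qed.

Lemma graph_sub_limit_graph (D : set R) (f : R -> R) : D !=set0 ->
  {within D, continuous f} -> exists s, graph_on D f `<=` limit_graph s.
Proof.
move=> [x0 Dx0] fc.
(* One point of [D] in each rational interval that meets [D] gives a dense sequence; the default
   [x0] keeps all its terms in [D]. *)
pose pick (r : rat * rat) : R := xget x0 [set x | D x /\ ratr r.1 < x < ratr r.2].
have pickD r : D (pick r) by rewrite /pick; case: xgetP => [x _ []|].
pose a n := if unpickle n is Some r then pick r else x0.
have aD n : D (a n) by rewrite /a; case: unpickle.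
exists (fun n => (a n, f (a n))) => -[x y] [/= Dx ->]; split => /=.
  move=> e e0; have /subspace_continuousP/(_ x Dx)/cvgr_dist_lt/(_ _ e0) := fc.
  rewrite near_withinE => /nbhs_ballP[d /= d0 dP]; exists d => // n nx.
  by rewrite distrC; apply: dP => //; rewrite /ball /= distrC.
move=> d d0.
have [|r1] := @rat_in_itvoo R (x - d) x _; first by lra.
have [|r2] := @rat_in_itvoo R x (x + d) _; first by lra.
rewrite !in_itv /= => /andP[r2l r2r] /andP[r1l r1r].
exists (pickle (r1, r2)); rewrite /a pickleK /pick.
case: xgetP => [z _ [_ /andP[/= zl zr]]|/(_ x) []]; last by rewrite /= r1r r2l.
by rewrite ltr_norml; lra.
Qed.

End Closure.

(** * The transfinite construction *)

Section Construction.
Variable R : realType.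
Implicit Types (p q : R * R) (L M : set (R * R)).

(* An index codes a line together with a rotated partial function: row 0 holds
   the coefficients of the line and the angle, rows 1 and 2 the sequence [s] of
   [limit_graph s]. *)
Local Notation index := (nat -> nat -> R).
Implicit Types x y : index.

(** A zero normal is replaced by [(1, 0)], so that every index codes a line. *)
Definition index_normal x : R * R :=
  if (x 0 0, x 0 1)%N == (0, 0) then (1, 0) else (x 0 0, x 0 1)%N.

Definition index_line x : set (R * R) :=
  [set p | (index_normal x).1 * p.1 + (index_normal x).2 * p.2 = x 0%N 2%N].

Definition index_angle x : R := x 0%N 3%N.

Definition index_seq x (n : nat) : R * R := (x 1%N n, x 2%N n).

Lemma is_line_index_line x : is_line (index_line x).
Proof.
exists (index_normal x).1, (index_normal x).2, (x 0%N 2%N); split => //.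
rewrite -surjective_pairing /index_normal; case: ifPn => [_ [/eqP]|/eqP//].
by rewrite oner_eq0.
Qed.

Lemma index_line_onto L : is_line L -> exists x, index_line x = L.
Proof.
move=> [a [b [c [ab ->]]]]; exists (fun _ j => nth 0 [:: a; b; c] j).
by rewrite /index_line /index_normal /=; move/eqP: ab => /negbTE ->.
Qed.

Lemma index_function_onto (t : R) (s : nat -> R * R) :
  exists x, index_angle x = t /\ index_seq x = s.
Proof.
exists (fun i j => if i is i'.+1 then if i' is 0%N then (s j).1 else (s j).2 else t).
by split => //; apply/funext => n; rewrite /index_seq -surjective_pairing.
Qed.

(** Graphs that [L] meets densely are exempt, since they may contain all of [L]. *)
Definition avoids (S : set index) L p : Prop := forall y, S y ->
  (forall r, ~ meets_densely (index_angle y) (index_seq y) L r) ->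
  ~ limit_graph (index_seq y) (rotation (index_angle y) p).

Definition no_three_collinear M : Prop := forall L p q r, is_line L ->
  M p -> M q -> M r -> L p -> L q -> L r -> [\/ p = q, p = r | q = r].

Lemma no_three_collinear_subset M M' :
  M `<=` M' -> no_three_collinear M' -> no_three_collinear M.
Proof. by move=> MM' nM' L p q r lL /MM' ? /MM' ? /MM' ?; exact: nM'. Qed.

Lemma no_three_collinearU1 M p : no_three_collinear M ->
  (forall q r L, M q -> M r -> q <> r -> is_line L -> L q -> L r -> ~ L p) ->
  no_three_collinear (M `|` [set p]).
Proof.
move=> nM pM L a b c lL [Ma|->] [Mb|->] [Mc|->] La Lb Lc.
- exact: (nM L).
- have [->|ab] := pselect (a = b); first exact: Or31.
  by case: (pM a b L).
- have [->|ac] := pselect (a = c); first exact: Or32.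
  by case: (pM a c L).
- exact: Or33.
- have [->|bc] := pselect (b = c); first exact: Or33.
  by case: (pM b c L).
- exact: Or32.
- exact: Or31.
- exact: Or31.
Qed.

(** * Completing one line *)

Hypothesis hcov : cov_meager_eq_continuum R.

(** In the parameter of [L], each forbidden set is nowhere dense and there are fewer than continuum
    many of them, so by [hcov] some parameter is left. *)
Lemma extend_point (S : set index) M L : small R S -> small R M -> is_line L ->
  no_three_collinear M ->
  (forall p q, M p -> L p -> M q -> L q -> p = q) ->
  exists p, [/\ L p, ~ M p, avoids S L p & no_three_collinear (M `|` [set p])].
Proof.
move=> Ss Ms lL nM ML; have [p0 [d [d0 Lp]]] := line_parametrization lL.
pose E y := [set u | limit_graph (index_seq y)
                       (rotation (index_angle y) (line_point p0 d u))].
pose good y := forall r, ~ meets_densely (index_angle y) (index_seq y) L r.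
(* Diagonal pairs exclude the points of [M] themselves, the other pairs exclude the lines through
   two points of [M]. *)
pose B (pq : (R * R) * (R * R)) := [set u |
  pq.1 = pq.2 /\ line_point p0 d u = pq.1 \/
  pq.1 <> pq.2 /\
    exists L', [/\ is_line L', L' pq.1, L' pq.2 & L' (line_point p0 d u)]].
pose F := E @` (S `&` good) `|` B @` (M `*` M).
have Fs : small R F.
  apply: small_setU; apply: small_image; last exact: small_setX.
  by apply: small_subset Ss => y [].
have Fm A : F A -> meager A.
  move=> [[y [Sy gy] <-]|[[p q] [/= Mp Mq] <-]]; apply: nowhere_dense_meager.
    exact: not_meets_densely_nowhere_dense d0 Lp gy.
  apply: subsingleton_nowhere_dense => u v /=.
  move=> [[pq eu]|[pq [L1 [l1 p1 q1 u1]]]] [[pq' ev]|[pq' [L2 [l2 p2 q2 v2]]]].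
  - exact: line_point_inj d0 _ _ (etrans eu (esym ev)).
  - by case: pq'.
  - by case: pq.
  (* Two common points would identify [L] with the line through [p] and [q], but [L] contains at
     most one point of [M]. *)
  apply: contrapT => uv.
  have L12 := line_unique l1 l2 pq p1 q1 p2 q2; subst L2.
  have uvp : line_point p0 d u <> line_point p0 d v.
    by move=> /(line_point_inj d0).
  have LL1 := line_unique l1 lL uvp u1 v2 (Lp u) (Lp v); subst L1.
  by apply: pq; apply: ML.
have [u uF] : exists u, ~ (\bigcup_(A in F) A) u.
  apply/existsNP => all; apply: (hcov (small_card_lt Fs) Fm).
  by apply/seteqP; split => // u _; exact: all.
exists (line_point p0 d u); split.
- exact: Lp.
- move=> Mp; apply: uF; exists (B (line_point p0 d u, line_point p0 d u)).
    by right; exists (line_point p0 d u, line_point p0 d u).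
  by left.
- by move=> y Sy gy Gy; apply: uF; exists (E y) => //; left; exists y.
- apply: no_three_collinearU1 nM _ => q r L' Mq Mr qr lL' L'q L'r L'p.
  apply: uF; exists (B (q, r)); first by right; exists (q, r).
  by right; split => //; exists L'.
Qed.

Definition stage_points (f : index -> (R * R) * (R * R)) (B : set index) :
    set (R * R) :=
  (fun y => (f y).1) @` B `|` (fun y => (f y).2) @` B.

Lemma stage_points_small f B : small R B -> small R (stage_points f B).
Proof. by move=> Bs; apply: small_setU; exact: small_image. Qed.

(** Points already in [M] may be chosen again; only new ones have to avoid the graphs. *)
Definition good_stage (S : set index) M L (v : (R * R) * (R * R)) : Prop :=
  [/\ v.1 <> v.2, L v.1 /\ L v.2, no_three_collinear (M `|` [set v.1; v.2]),
      M v.1 \/ avoids S L v.1 & M v.2 \/ avoids S L v.2].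

(** If [L] contains two points of [M], these are reused. Otherwise [extend_point] supplies the
    missing ones, the first being added to [M] before the second is sought. *)
Lemma good_stage_exists (S : set index) M L : small R S -> small R M ->
  is_line L -> no_three_collinear M -> exists v, good_stage S M L v.
Proof.
move=> Ss Ms lL nM.
have one p : M p -> L p -> (forall q, M q -> L q -> q = p) ->
    exists v, good_stage S M L v.
  move=> Mp Lp uniq.
  have [|q [Lq nMq Sq nMq3]] := extend_point Ss Ms lL nM.
    by move=> a b Ma La Mb Lb; rewrite (uniq a) // (uniq b).
  exists (p, q); split => //=; first by move=> pq; apply: nMq; rewrite -pq.
  - apply: no_three_collinear_subset nMq3 => r [Mr|[->|->]]; [by left|by left|].
    by right.
  - by left.
  - by right.
have [[p [Mp Lp]]|/forallNP none] := pselect (exists p, M p /\ L p).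
  have [[q [Mq Lq qp]]|/forallNP uniq] := pselect (exists q, [/\ M q, L q & q <> p]).
    exists (q, p); split => //=; [|by left|by left].
    by apply: no_three_collinear_subset nM => r [//|[->|->]].
  by apply: (one p) => // q Mq Lq; apply: contrapT => qp; apply: (uniq q).
have [|p [Lp nMp Sp nMp3]] := extend_point Ss Ms lL nM.
  by move=> p q Mp Lp; case: (none p).
have p_s : small R [set p] by exact/countable_small/countable1.
have [|q [Lq nMq Sq nMq3]] := extend_point Ss (small_setU Ms p_s) lL nMp3.
  by move=> a b [Ma La|-> _] [Mb Lb|-> _] //; [case: (none a)|case: (none a)|case: (none b)].
exists (p, q); split => //=; [|..|by right|by right].
  by move=> pq; apply: nMq; right.
by apply: no_three_collinear_subset nMq3 => r; rewrite setUA.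
Qed.

(** * The set of all chosen points *)

Section Transfinite.
Variable lt : index -> index -> Prop.
Hypothesis lt_wo : strict_well_order lt.
Variable f : index -> (R * R) * (R * R).

Local Notation seg x := [set y | lt y x].

(** Any three points are all present at the latest of their stages. The case of an initial segment
    [B] serves during the recursion, the case [setT] afterwards. *)
Lemma stage_points_no_three_collinear (B : set index) :
  (forall y, B y -> no_three_collinear
     (stage_points f (seg y) `|` [set (f y).1; (f y).2])) ->
  no_three_collinear (stage_points f B).
Proof.
have [_ lt_trans lt_tot] := lt_wo.
move=> nB L p q r lL Bp Bq Br Lp Lq Lr.
pose le y w := y = w \/ lt y w.
have le_trans y z w : le y z -> le z w -> le y w.
  move=> [->//|yz] [<-|zw]; first by right.
  by right; exact: lt_trans zw.
have stageE a : stage_points f B a ->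
    exists2 y, B y & a = (f y).1 \/ a = (f y).2.
  by move=> [] [y By <-]; exists y => //; [left|right].
have stageI a y w : a = (f y).1 \/ a = (f y).2 -> le y w ->
    (stage_points f (seg w) `|` [set (f w).1; (f w).2]) a.
  by move=> [|] -> [->|yw]; [right; left|left; left; exists y
                            |right; right|left; right; exists y].
have max y z : B y -> B z -> exists w, [/\ B w, le y w & le z w].
  move=> By Bz; case: (lt_tot y z) => [yz|<-|zy].
  - by exists z; split => //; [right|left].
  - by exists y; split => //; left.
  - by exists y; split => //; [left|right].
have [y1 By1 py1] := stageE _ Bp.
have [y2 By2 py2] := stageE _ Bq.
have [y3 By3 py3] := stageE _ Br.
have [z [Bz y1z y2z]] := max _ _ By1 By2.
have [w [Bw zw y3w]] := max _ _ Bz By3.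
apply: (nB w Bw L) => //.
- exact: stageI py1 (le_trans _ _ _ y1z zw).
- exact: stageI py2 (le_trans _ _ _ y2z zw).
- exact: stageI py3 y3w.
Qed.

Hypothesis lt_small : forall x, small R (seg x).
Hypothesis f_good : forall x,
  good_stage (seg x) (stage_points f (seg x)) (index_line x) (f x).

Local Notation M := (stage_points f setT).

Lemma stage_points_mazurkiewicz : mazurkiewicz M.
Proof.
have nM : no_three_collinear M.
  by apply: stage_points_no_three_collinear => y _; have [] := f_good y.
move=> L lL; have [x xL] := index_line_onto lL.
have [v12 [] + + _ _ _] := f_good x; rewrite xL => L1 L2.
have M1 : M (f x).1 by left; exists x.
have M2 : M (f x).2 by right; exists x.
exists (f x).1, (f x).2; split => //.
apply/seteqP; split => [p [Mp Lp]|p [->|->]//].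
by have [|<-|<-] := nM L _ _ _ lL M1 M2 Mp L1 L2 Lp; [|left|right].
Qed.

Lemma stage_points_limit_graph_small x : small R
  (M `&` [set p | limit_graph (index_seq x) (rotation (index_angle x) p)]).
Proof.
have [lt_wf _ lt_tot] := lt_wo.
pose bad L := exists r, meets_densely (index_angle x) (index_seq x) L r.
pose dense r L := is_line L /\ meets_densely (index_angle x) (index_seq x) L r.
(* The points of [M] on exceptional lines: each [r] admits at most one such line, and it carries two
   points of [M]. *)
pose C := \bigcup_(r in [set: rat * rat]) [set p | M p /\ exists2 L, dense r L & L p].
have C_s : small R C.
  apply: countable_small; apply: bigcup_countable => [|r _]; first exact: countableP.
  have [[L [lL rL]]|/forallNP none] := pselect (exists L, dense r L); last first.
    rewrite (_ : [set p | _] = set0); first exact: countable0.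
    by apply/seteqP; split => // p [_ [L /none]].
  have [p [q [_ MLE]]] := stage_points_mazurkiewicz lL.
  apply: (@sub_countable _ _ _ [set p; q]); last first.
    by apply: finite_set_countable; exact: finite_set2.
  apply: subset_card_le => a [Ma [L' [lL' rL'] L'a]]; rewrite -MLE; split => //.
  by rewrite (meets_densely_unique lL lL' rL rL').
have x_s : small R (seg x `|` [set x]).
  by apply: small_setU => //; exact/countable_small/countable1.
have := small_setU (stage_points_small (f := f) x_s) C_s.
apply: small_subset => p [Mp Gp].
(* By well-founded induction, [y] may be taken as the first stage at which [p] is chosen. *)
suff new y : ~ (stage_points f (seg y)) p -> p = (f y).1 \/ p = (f y).2 ->
    (stage_points f (seg x `|` [set x]) `|` C) p.
  have [y py] : exists y, p = (f y).1 \/ p = (f y).2.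
    by case: Mp => -[y _ <-]; exists y; [left|right].
  have := lt_wf y; move: py => /[swap]; elim=> {}y _ IH py.
  have [[[z zy pz]|[z zy pz]]|] := pselect (stage_points f (seg y) p).
  - by apply: (IH z zy); left.
  - by apply: (IH z zy); right.
  - by move=> /new; apply.
move=> py_new py; have [v12 [L1 L2] _ av1 av2] := f_good y.
have Lp : index_line y p by case: py => ->.
have av : avoids (seg y) (index_line y) p.
  by case: py py_new => -> ny; [case: av1|case: av2].
have old : (seg x `|` [set x]) y -> (stage_points f (seg x `|` [set x]) `|` C) p.
  by move=> xy; left; case: py => ->; [left|right]; exists y.
(* If [p] first appears after stage [x], it avoids the graph of [x] unless the line of stage [y] is
   exceptional. *)
case: (lt_tot x y) => [xy|e|yx]; [|by apply: old; right|by apply: old; left].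
right; have [[r rL]|/forallNP nL] := pselect (bad (index_line y)); last first.
  by case: (av x xy nL Gp).
exists r => //; split => //; exists (index_line y) => //; split => //.
exact: is_line_index_line.
Qed.

End Transfinite.

End Construction.

Theorem theorem4p5 (R : realType) (hcov : cov_meager_eq_continuum R) :
  exists M : set (R * R),
    mazurkiewicz M /\ forall t : R, sierpinski_zygmund (rotation t @` M).
Proof.
have [lt lt_wo lt_init] := initial_well_order (nat -> nat -> R).
have lt_small x : small R [set y | lt y x].
  by move=> Rx; apply: (lt_init x); exact: card_le_trans (card_seq2_le_real R) Rx.
have [lt_wf _ _] := lt_wo.
have [||f f_good] := @wf_choice _ _ lt (fun x f v =>
    good_stage [set y | lt y x] (stage_points f [set y | lt y x]) (index_line x) v)
    ((0, 0), (0, 0)) lt_wf.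
- move=> x f g v fg.
  suff -> : stage_points f [set y | lt y x] = stage_points g [set y | lt y x] by [].
  by congr (_ `|` _); apply: eq_imagel => y /fg ->.
- move=> x f IH; apply: good_stage_exists => //.
  + exact: stage_points_small.
  + exact: is_line_index_line.
  + apply: (stage_points_no_three_collinear lt_wo) => y /IH; by case.
exists (stage_points f setT); split; first exact: (stage_points_mazurkiewicz lt_wo f_good).
move=> t D g gc; apply: small_card_lt.
(* An empty domain has no point to sample and is treated apart. *)
have [D0|/nonemptyPn D0] := pselect (D !=set0); last first.
  rewrite (_ : _ `&` _ = set0); first exact/countable_small/countable0.
  by apply/seteqP; split => // p [_ []]; rewrite D0.
have [s sP] := graph_sub_limit_graph D0 gc.
have [x [xt xs]] := index_function_onto t s.
have := stage_points_limit_graph_small lt_wo lt_small f_good (x := x).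
move=> /(small_image (f := rotation t)); apply: small_subset.
by rewrite xt xs => _ [[p Mp <-] /sP Gp]; exists p.
Qed.
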